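(* Let $T\colon H\to K$ be a Hilbert--Schmidt operator with positive singular numbers $s_1\ge s_2\ge\dots>0$ such that, for a constant $C_r$, $$\frac{m}{s_m^2}\le C_r^2\sum_{j=1}^m\frac1{s_j^2},\qquad m=1,2,\dots$$ Let a projection scheme $R_m=(Q_{n(m)}TP_m)^\dagger$, $m\in\mathbb N$, be quasi-optimal with constant $D_Q$ and robust with constant $D_R$. Let $\varphi$ be an index function, and assume that the design spaces $H_m$ have degree of approximation $\varphi$ with constant $C_D$ and obey a Bernstein-type inequality with constant $C_B$. Let $\alpha,\beta\in(0,1)$, $\sigma>0$, and let $$m_*=\max\left\{m:\ \varphi^2(s_m^2)\ge\sigma^2\frac{\sqrt{\mathcal N(s_m^2)}}{s_m^2}\right\}$$ (assumed to exist). If $f\in\mathcal E_\varphi$, then $$\inf_m\left\{r^2(\Phi_{\alpha,R_m},\beta)+\|f-f_m\|^2\right\}\le\left(C^*_{\alpha,\beta}\frac{D_R^2}{C_B^2}C_r+(4x_\alpha+8x_\beta)\frac{D_R^2}{C_B^2}\frac1{\sqrt{\mathcal N(s_{m_*}^2)}}+D_Q^2C_D^2\right)\varphi^2(s_{m_*}^2).$$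
   Context: $H,K$ are separable Hilbert spaces, and $\sigma>0$ is the noise level in the model $Y=Tf+\sigma\xi$ with $\xi$ Gaussian white noise on $K$. For a Hilbert--Schmidt operator $R\colon K\to H$ put $S_R^2=\sigma^2\operatorname{tr}[R^*R]$ and $v_R^2=\sigma^2\|R\|^2$ ($S_R,v_R\ge0$). With $x_\alpha=\log(1/\alpha)$, $x_\beta=\log(1/\beta)$ and $C^*_{\alpha,\beta}=4\sqrt{x_\beta}+4\sqrt{2x_\alpha}$, set $r^2(\Phi_{\alpha,R},\beta)=C^*_{\alpha,\beta}S_Rv_R+(4x_\alpha+8x_\beta)v_R^2$. (Here $\Phi_{\alpha,R}$ is the test rejecting $f=0$ when $\|RY\|^2-S_R^2$ exceeds its $(1-\alpha)$-quantile under $f=0$.) Projection scheme: $H_1\subset H_2\subset\dots\subset H$ and $K_1\subset K_2\subset\dots\subset K$ are increasing sequences of subspaces with $\dim H_m=m$, $\dim K_n=n$, with orthogonal projections $P_m$ onto $H_m$ and $Q_n$ onto $K_n$, together with a map $m\mapsto n(m)$. The reconstructions are $R_m=(Q_{n(m)}TP_m)^\dagger\colon K\to H$ (Moore--Penrose inverse), and $f_m=R_mTf$. It is assumed throughout that $(Q_{n(m)}TP_m)^\dagger\colon K_{n(m)}\to H_m$ is invertible, i.e. the discretized linear system has a unique solution. Robust with constant $D_R<\infty$: $\|(Q_{n(m)}TP_m)^\dagger\|\le D_R/\mathrm j(T,H_m)$ for all $m$, where $\mathrm j(T,H_m)=\inf_{0\ne x\in H_m}\|Tx\|/\|x\|$.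 Bernstein-type inequality with constant $0<C_B\le1$: $C_Bs_m\le\mathrm j(T,H_m)$ for all $m$. Quasi-optimal with constant $D_Q$: $\|(Q_{n(m)}TP_m)^\dagger T\|\le D_Q$ for all $m$. Degree of approximation $\varphi$ with constant $C_D<\infty$: $\|(I-P_m)\varphi(T^*T)\|\le C_D\varphi(s_{m+1}^2)$ for all $m$. An index function is a continuous non-decreasing $\varphi\colon[0,\infty)\to[0,\infty)$ with $\varphi(0)=0$; $\mathcal E_\varphi=\{\varphi(T^*T)\omega:\ \omega\in H,\|\omega\|\le1\}$. The effective dimension is $\mathcal N(\lambda)=\operatorname{tr}[(T^*T+\lambda I)^{-1}T^*T]$. *)

(* Defs.v *)
From HB Require Import structures.
From mathcomp Require Import all_boot all_order all_algebra.
From mathcomp Require Import all_classical all_reals all_analysis.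

Set Implicit Arguments.
Unset Strict Implicit.
Unset Printing Implicit Defensive.

Import Order.TTheory GRing.Theory Num.Theory.
Import numFieldNormedType.Exports.

Local Open Scope classical_set_scope.
Local Open Scope ring_scope.

(* Sequences that are numbered 1, 2, ... in the mathematics ([s], [u], [v], the
   subspaces [Hm], [Kn], ...) are functions on [nat] whose value at 0 is never
   used. *)

HB.mixin Record isHilbert (R : realType) V & CompleteNormedModule R V := {
  inner : {dot V for (@idfun R)} ;
  inner_sqr_norm : forall x : V, inner x x = `|x| ^+ 2
}.

#[short(type="hilbertType")]
HB.structure Definition Hilbert (R : realType) :=
  {V of isHilbert R V & CompleteNormedModule R V}.

Definition separable (V : topologicalType) : Prop :=
  exists D : set V, countable D /\ dense D.

Section Operators.
Context {R : realType} {H K : hilbertType R}.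

(* Extended-real valued: [opnorm A = +oo] iff [A] is unbounded on the ball. *)
Definition opnorm (A : H -> K) : \bar R :=
  ereal_sup [set `|A x|%:E | x in [set x | `|x| <= 1]].

(* Hilbert space adjoint, meaningful for bounded linear [A]. *)
Definition adjoint (A : H -> K) (y : K) : H :=
  xget 0 [set x | forall z, inner (A z) y = inner z x].

(* The Moore-Penrose inverse is characterized by the four Penrose equations. *)
Definition is_mp_inverse (A : H -> K) (B : K -> H) : Prop :=
  [/\ linear B, continuous B,
      (forall x, A (B (A x)) = A x) /\ (forall y, B (A (B y)) = B y),
      (forall y y', inner (A (B y)) y' = inner y (A (B y'))) &
      (forall x x', inner (B (A x)) x' = inner x (B (A x')))].

Definition mp_inverse (A : H -> K) : K -> H :=
  xget (cst 0) [set B | is_mp_inverse A B].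

End Operators.

Section Trace.
Context {R : realType} {H : hilbertType R}.

Definition is_hilbert_basis (B : set H) : Prop :=
  (forall e e', B e -> B e' -> inner e e' = (e == e')%:R) /\
  (forall x, (forall e, B e -> inner x e = 0) -> x = 0).

Definition hilbert_basis : set H := xget set0 [set B | is_hilbert_basis B].

(* Only for positive operators, where it does not depend on the basis: [esum] is
   a supremum of finite partial sums. *)
Definition trace (A : H -> H) : \bar R :=
  \esum_(e in hilbert_basis) (inner (A e) e)%:E.

Definition subspace_of_dim (V : set H) (m : nat) : Prop :=
  exists e : 'I_m -> H,
    (forall a : 'I_m -> R, \sum_i a i *: e i = 0 -> forall i, a i = 0) /\
    V = range (fun a : 'I_m -> R => \sum_i a i *: e i).

Definition orth_proj (V : set H) (x : H) : H :=
  xget 0 [set p | V p /\ forall y, V y -> inner (x - p) y = 0].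

Definition subspace_chain (V : nat -> set H) : Prop :=
  forall m, (0 < m)%N -> subspace_of_dim (V m) m /\ V m `<=` V m.+1.

End Trace.

Section Model.
Context {R : realType} {H K : hilbertType R}.

Definition hilbert_schmidt (T : {linear H -> K}) : Prop :=
  continuous T /\ (trace (adjoint T \o T) < +oo)%E.

(* [s] lists the positive singular numbers of [T], with multiplicity, and [u],
   [v] are associated orthonormal systems (Schmidt decomposition of [T]). *)
Definition singular_system (T : H -> K) (s : nat -> R) (u : nat -> H)
    (v : nat -> K) : Prop :=
  [/\ forall j, (0 < j)%N -> 0 < s j /\ s j.+1 <= s j,
      forall j k, (0 < j)%N -> (0 < k)%N -> inner (u j) (u k) = (j == k)%:R,
      forall j k, (0 < j)%N -> (0 < k)%N -> inner (v j) (v k) = (j == k)%:R &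
      forall x, (\sum_(1 <= j < N) (s j * inner x (u j)) *: v j) @[N --> \oo]
                --> T x].

Definition index_function (phi : R -> R) : Prop :=
  [/\ {within [set t | 0 <= t], continuous phi},
      forall t t', 0 <= t -> t <= t' -> phi t <= phi t',
      forall t, 0 <= t -> 0 <= phi t &
      phi 0 = 0].

(* phi(T^*T) by spectral calculus, for a singular system of [T]: the u_j are the
   eigenvectors of T^*T for its nonzero eigenvalues s_j^2, and the kernel of
   T^*T does not contribute because phi(0) = 0. *)
Definition phi_TT (s : nat -> R) (u : nat -> H) (phi : R -> R) (x : H) : H :=
  limn (fun N => \sum_(1 <= j < N) (phi (s j ^+ 2) * inner x (u j)) *: u j).

Definition source_set (s : nat -> R) (u : nat -> H) (phi : R -> R) : set H :=
  [set phi_TT s u phi w | w in [set w | `|w| <= 1]].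

(* tr[(T^*T + lambda I)^-1 T^*T], finite for lambda > 0. *)
Definition eff_dim (T : H -> K) (lambda : R) : R :=
  let TT := adjoint T \o T in
  fine (trace ('pinv_(cst 0) setT (fun x => TT x + lambda *: x) \o TT)).

Definition injectivity_modulus (T : H -> K) (V : set H) : R :=
  inf [set `|T x| / `|x| | x in V `\ 0].

Definition reconstruction (T : H -> K) (Hm : nat -> set H) (Kn : nat -> set K)
    (n : nat -> nat) (m : nat) : K -> H :=
  mp_inverse (orth_proj (Kn (n m)) \o T \o orth_proj (Hm m)).

(* The last clause is the unique solvability of the discretized systems; comparing
   dimensions, it forces n m = m. *)
Definition projection_scheme (T : H -> K) (Hm : nat -> set H)
    (Kn : nat -> set K) (n : nat -> nat) : Prop :=
  [/\ subspace_chain Hm, subspace_chain Kn &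
      forall m, (0 < m)%N -> (0 < n m)%N /\
        set_bij (Kn (n m)) (Hm m) (reconstruction T Hm Kn n m)].

Definition robust (T : H -> K) (Hm : nat -> set H) (Rm : nat -> K -> H)
    (D : R) : Prop :=
  forall m, (0 < m)%N ->
    (opnorm (Rm m) <= (D / injectivity_modulus T (Hm m))%:E)%E.

Definition quasi_optimal (T : H -> K) (Rm : nat -> K -> H) (D : R) : Prop :=
  forall m, (0 < m)%N -> (opnorm (Rm m \o T) <= D%:E)%E.

Definition bernstein (T : H -> K) (s : nat -> R) (Hm : nat -> set H)
    (C : R) : Prop :=
  [/\ 0 < C, C <= 1 &
      forall m, (0 < m)%N -> C * s m <= injectivity_modulus T (Hm m)].

Definition degree_of_approximation (s : nat -> R) (u : nat -> H)
    (Hm : nat -> set H) (phi : R -> R) (C : R) : Prop :=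
  forall m, (0 < m)%N ->
    (opnorm (fun x => let y := phi_TT s u phi x in (y - orth_proj (Hm m) y)%R)
     <= (C * phi (s m.+1 ^+ 2))%:E)%E.

(* S_R^2 and v_R^2 for a Hilbert-Schmidt operator [A] from data to solutions. *)
Definition S2 (sigma : R) (A : K -> H) : R :=
  sigma ^+ 2 * fine (trace (adjoint A \o A)).

Definition v2 (sigma : R) (A : K -> H) : R :=
  sigma ^+ 2 * fine (opnorm A) ^+ 2.

End Model.

Section Radius.
Context {R : realType}.

Definition xlog (a : R) : R := ln (1 / a).

Definition Cstar (alpha beta : R) : R :=
  4 * Num.sqrt (xlog beta) + 4 * Num.sqrt (2 * xlog alpha).

Definition radius2 {H K : hilbertType R} (alpha beta sigma : R)
    (A : K -> H) : R :=
  Cstar alpha beta * Num.sqrt (S2 sigma A) * Num.sqrt (v2 sigma A)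
  + (4 * xlog alpha + 8 * xlog beta) * v2 sigma A.

End Radius.

Definition is_max_index (P : nat -> Prop) (m : nat) : Prop :=
  [/\ (0 < m)%N, P m & forall k, (0 < k)%N -> P k -> (k <= m)%N].

(* Main.v *)
Require Import Defs.
From HB Require Import structures.
From mathcomp Require Import all_boot all_order all_algebra.
From mathcomp Require Import all_classical all_reals all_analysis.
From mathcomp Require Import ring lra zify.

Set Implicit Arguments.
Unset Strict Implicit.
Unset Printing Implicit Defensive.

Import Order.TTheory GRing.Theory Num.Theory.
Import numFieldNormedType.Exports.

Local Open Scope classical_set_scope.
Local Open Scope ring_scope.

(** The infimum is bounded by its value at the single index [m = mstar], whose
    two summands are estimated separately.

    Noise. The range of [R_m] is [H_m], of dimension [m], so that
    [tr (R_m^* R_m) <= m |R_m|^2] ([trace_adjoint_le]); robustness and the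
    Bernstein inequality give [|R_m| <= D_R / (C_B s_m)]. Thus [S_R v_R] is at
    most [sqrt m sigma^2 D_R^2 / (C_B s_m)^2], whereas the definition of [mstar]
    controls [sqrt N(s_m^2) sigma^2 / s_m^2] by [phi(s_m^2)^2]. What remains to
    be seen is [m <= Cr^2 N(s_m^2)]. Each of the first [m] eigenvalues
    [s_j^2 / (s_j^2 + s_m^2)] of [(T^* T + s_m^2)^-1 T^* T] is at least 1/2, so
    [N(s_m^2) >= m / 2] ([eff_dim_ge_half]); and [Cr^2 >= 2], because with a
    smaller constant the assumption on the singular numbers would make the
    [s_j^2] decay no faster than [1/j], against the Hilbert-Schmidt property
    ([decay_const_ge2]).

    Bias. The operator [R_m T] is idempotent with range [H_m]. So [I - R_m T]
    vanishes on [H_m], which gives [f - f_m = (I - R_m T) (f - P_m f)], and the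
    norm of [I - R_m T] is that of [R_m T] ([idempotent_compl_le]), at most
    [D_Q]. The degree of approximation bounds [f - P_m f].

    Traces are sums over an unspecified Hilbert basis. They are compared with
    sums over the singular system through the Parseval identity
    ([parseval_sum]). Adjoints and the resolvent of [T^* T] are obtained as
    orthogonal series ([riesz_fischer]). *)

(** * Inner products and orthonormal families *)

Section InnerProduct.
Context {R : realType} {V : hilbertType R}.
Implicit Types (x y z : V) (a : R).

Lemma innerC x y : inner x y = inner y x.
Proof. by rewrite (hermC inner) expr0 mul1r. Qed.

Lemma innerDl x y z : inner (x + y) z = inner x z + inner y z.
Proof. exact: linearDl. Qed.

Lemma innerZl a x z : inner (a *: x) z = a * inner x z.
Proof. exact: linearZl_LR. Qed.

Lemma innerNl x z : inner (- x) z = - inner x z.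
Proof. by rewrite -scaleN1r innerZl mulN1r. Qed.

Lemma innerBl x y z : inner (x - y) z = inner x z - inner y z.
Proof. by rewrite innerDl innerNl. Qed.

Lemma inner0l z : inner 0 z = 0.
Proof. by rewrite -(scale0r z) innerZl mul0r. Qed.

Lemma innerDr x y z : inner z (x + y) = inner z x + inner z y.
Proof. by rewrite !(innerC z) innerDl. Qed.

Lemma innerZr a x z : inner z (a *: x) = a * inner z x.
Proof. by rewrite !(innerC z) innerZl. Qed.

Lemma innerBr x y z : inner z (x - y) = inner z x - inner z y.
Proof. by rewrite !(innerC z) innerBl. Qed.

Lemma inner0r z : inner z 0 = 0.
Proof. by rewrite innerC inner0l. Qed.

Lemma inner_suml (I : Type) (r : seq I) (F : I -> V) z :
  inner (\sum_(i <- r) F i) z = \sum_(i <- r) inner (F i) z.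
Proof.
elim: r => [|i r IH]; first by rewrite !big_nil inner0l.
by rewrite !big_cons innerDl IH.
Qed.

Lemma inner_sumr (I : Type) (r : seq I) (F : I -> V) z :
  inner z (\sum_(i <- r) F i) = \sum_(i <- r) inner z (F i).
Proof. by rewrite innerC inner_suml; apply: eq_bigr => i _; rewrite innerC. Qed.

Lemma sqr_normD x y : `|x + y| ^+ 2 = `|x| ^+ 2 + 2 * inner x y + `|y| ^+ 2.
Proof.
rewrite -!inner_sqr_norm !innerDl !innerDr (innerC y x) mulr_natl mulr2n.
by rewrite !addrA.
Qed.

Lemma sqr_normB x y : `|x - y| ^+ 2 = `|x| ^+ 2 - 2 * inner x y + `|y| ^+ 2.
Proof. by rewrite sqr_normD innerC innerNl innerC mulrN normrN. Qed.

Lemma sqr_normB_le x y : `|x - y| ^+ 2 <= 2 * `|x| ^+ 2 + 2 * `|y| ^+ 2.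
Proof.
rewrite -subr_ge0 (_ : _ - _ = `|x + y| ^+ 2) ?sqr_ge0 //.
by rewrite sqr_normB sqr_normD; ring.
Qed.

Lemma inner_eq0 x : inner x x = 0 -> x = 0.
Proof.
by rewrite inner_sqr_norm => /eqP; rewrite sqrf_eq0 normr_eq0 => /eqP.
Qed.

Lemma cauchy_schwarz x y : `|inner x y| <= `|x| * `|y|.
Proof.
have [->|y0] := eqVneq y 0; first by rewrite inner0r !normr0 mulr0.
have y2 : 0 < `|y| ^+ 2 by rewrite exprn_gt0 // normr_gt0.
rewrite -ler_sqr ?nnegrE ?mulr_ge0 // -normrX ger0_norm ?sqr_ge0 //.
(* the squared distance from [x] to its projection on the line of [y] *)
have := sqr_ge0 `|x - (inner x y / `|y| ^+ 2) *: y|.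
rewrite sqr_normB innerZr normrZ exprMn real_normK ?num_real //.
have -> : `|x| ^+ 2 - 2 * (inner x y / `|y| ^+ 2 * inner x y)
  + (inner x y / `|y| ^+ 2) ^+ 2 * `|y| ^+ 2
  = `|x| ^+ 2 - inner x y ^+ 2 / `|y| ^+ 2.
  by field; rewrite normr_eq0.
by rewrite subr_ge0 ler_pdivrMr // exprMn.
Qed.

End InnerProduct.

(** Relative to a sequence of indices, so that one notion serves ordinals,
    initial segments of a sequence of vectors numbered from 1, and finite
    subsets of a Hilbert basis. *)
Definition orthonormal_on (R : realType) (V : hilbertType R) (I : eqType)
    (r : seq I) (e : I -> V) :=
  {in r &, forall i j, inner (e i) (e j) = (i == j)%:R}.

Section Orthonormal.
Context {R : realType} {V : hilbertType R}.
Context {I : eqType} {r : seq I} {e : I -> V}.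
Hypotheses (r_uniq : uniq r) (r_on : orthonormal_on r e).

Lemma inner_onsum (a : I -> R) i :
  i \in r -> inner (\sum_(j <- r) a j *: e j) (e i) = a i.
Proof.
move=> ir; rewrite inner_suml (bigD1_seq i) //= innerZl r_on // eqxx mulr1.
rewrite big_seq_cond big1 ?addr0 // => j /andP[jr ji].
by rewrite innerZl r_on // (negbTE ji) mulr0.
Qed.

Lemma pythagoras (a : I -> R) :
  `|\sum_(i <- r) a i *: e i| ^+ 2 = \sum_(i <- r) a i ^+ 2.
Proof.
rewrite -inner_sqr_norm inner_sumr big_seq [RHS]big_seq.
by apply: eq_bigr => i ir; rewrite innerZr inner_onsum // expr2.
Qed.

(** The distance from [x] to the span of the family. *)
Lemma bessel_gap x :
  `|x - \sum_(i <- r) inner x (e i) *: e i| ^+ 2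
  = `|x| ^+ 2 - \sum_(i <- r) inner x (e i) ^+ 2.
Proof.
rewrite sqr_normB pythagoras inner_sumr.
under eq_bigr => i _ do rewrite innerZr -expr2.
by ring.
Qed.

Lemma bessel x : \sum_(i <- r) inner x (e i) ^+ 2 <= `|x| ^+ 2.
Proof. by rewrite -subr_ge0 -bessel_gap sqr_ge0. Qed.

End Orthonormal.

(** * Convergence of orthogonal series *)

Lemma cvg_seq_unique (R : realType) (f : nat -> R) (a b : R) :
  f @ \oo --> a -> f @ \oo --> b -> a = b.
Proof. by move=> fa; apply: (cvg_unique _ fa). Qed.

Lemma cvg_ext (U : topologicalType) (f g : nat -> U) (l : U) :
  f =1 g -> f @ \oo --> l -> g @ \oo --> l.
Proof. by move=> /funext ->. Qed.

Section Convergence.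
Context {R : realType} {V : hilbertType R}.

(** Completeness, with Cauchy sequences described by squared distances, which
    are what orthogonality computes. *)
Lemma sqr_cauchy_cvg (w : nat -> V) :
  (forall eps, 0 < eps -> exists N, forall n m, (N <= n)%N -> (N <= m)%N ->
     `|w n - w m| ^+ 2 < eps) ->
  exists l : V, w @ \oo --> l.
Proof.
move=> wC; suff wc : cvgn w by exists (lim (w @ \oo)).
apply/cauchy_cvgP/cauchy_exP => eps eps0.
have [N NP] := wC (eps ^+ 2) (exprn_gt0 2 eps0).
exists (w N); exists N => // n /= Nn.
rewrite -ball_normE /ball_ /=.
by rewrite -ltr_sqr ?nnegrE ?(ltW eps0) // NP.
Qed.

Lemma cvg_inner (w : nat -> V) (l x : V) :
  w @ \oo --> l -> (fun n => inner (w n) x) @ \oo --> inner l x.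
Proof.
move=> wl; apply/cvgrPdist_le => eps eps0.
have d0 : 0 < eps / (`|x| + 1) by rewrite divr_gt0 // ltr_pwDr.
move/cvgrPdist_le: wl => /(_ _ d0)[N _ NP]; exists N => // n Nn /=.
rewrite -innerBl (le_trans (cauchy_schwarz _ _)) //.
have xle : `|x| <= `|x| + 1 by rewrite lerDl.
rewrite (le_trans (ler_pM _ _ (NP _ Nn) xle)) // divfK //.
Qed.

(** Partial sums of the squares are monotone and bounded, hence Cauchy, and
    Pythagoras carries the Cauchy property over to the vectors. *)
Lemma riesz_fischer (u : nat -> V) (c : nat -> R) (M : R) :
  (forall j k, (0 < j)%N -> (0 < k)%N -> inner (u j) (u k) = (j == k)%:R) ->
  (forall N, \sum_(1 <= j < N) c j ^+ 2 <= M) ->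
  exists z : V, (\sum_(1 <= j < N) c j *: u j) @[N --> \oo] --> z.
Proof.
move=> u_on cM; apply: sqr_cauchy_cvg => eps eps0.
pose C N := \sum_(1 <= j < N) c j ^+ 2.
have Cnd : nondecreasing_seq C.
  move=> n m nm; rewrite /C; case: (leqP 1 n) => n1.
    by rewrite (big_cat_nat n1 nm) /= lerDl sumr_ge0 // => i _; exact: sqr_ge0.
  rewrite [X in X <= _]big_geq; last exact: ltnW.
  by rewrite sumr_ge0 // => i _; exact: sqr_ge0.
have /cvg_ex[L CL] : cvgn C.
  apply: nondecreasing_is_cvgn => //.
  by exists M => _ [N _ <-]; exact: cM.
have e2 : 0 < eps / 2 by lra.
move/cvgrPdist_lt: CL => /(_ _ e2)[N _ NP].
exists N.+1 => n m Nn Nm.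
wlog nm : n m Nn Nm / (n <= m)%N.
  move=> H; case/orP: (leq_total n m) => le; first exact: H.
  by rewrite distrC H.
have n1 : (1 <= n)%N by exact: leq_trans Nn.
rewrite (big_cat_nat n1 nm) /= opprD addrA subrr sub0r normrN pythagoras.
- have -> : \sum_(n <= i < m) c i ^+ 2 = C m - C n.
    by rewrite /C (big_cat_nat n1 nm) /= addrC addrK.
  have := NP _ (ltnW Nn); have := NP _ (ltnW Nm); rewrite /= !ltr_norml.
  by move=> /andP[? ?] /andP[? ?]; lra.
- exact: iota_uniq.
- move=> i j; rewrite !mem_index_iota => /andP[ni _] /andP[nj _].
  by apply: u_on; [exact: leq_trans ni|exact: leq_trans nj].
Qed.

Lemma inner_series_coef (u : nat -> V) (c : nat -> R) (z : V) :
  (forall j k, (0 < j)%N -> (0 < k)%N -> inner (u j) (u k) = (j == k)%:R) ->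
  (\sum_(1 <= j < N) c j *: u j) @[N --> \oo] --> z ->
  forall k, (0 < k)%N -> inner z (u k) = c k.
Proof.
move=> u_on cz k k0; apply: (cvg_seq_unique (cvg_inner (x := u k) cz)).
apply: (@cvg_near_cst _ _ (c k)).
exists k.+1 => // N /= kN.
rewrite (@inner_onsum _ _ _ (index_iota 1 N)) ?iota_uniq ?mem_index_iota ?k0 //.
move=> i j; rewrite !mem_index_iota => /andP[ni _] /andP[nj _].
exact: u_on.
Qed.

End Convergence.

(** * Hilbert bases *)

Section HilbertBasis.
Context {R : realType} {V : hilbertType R}.

(** A maximal orthonormal set, obtained from Zorn's lemma, is total. *)
Lemma hilbert_basisP : is_hilbert_basis (@hilbert_basis R V).
Proof.
pose P (B : set V) := forall e e', B e -> B e' -> inner e e' = (e == e')%:R.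
have [F FP Ftot|B [PB Bmax]] := @Zorn_bigcup V P.
  move=> e e' [X FX Xe] [Y FY Ye'].
  by have [XY|YX] := Ftot _ _ FX FY; [apply: (FP Y) => //; exact: XY
    |apply: (FP X) => //; exact: YX].
rewrite /hilbert_basis; case: xgetP => [C -> //|noB].
exfalso; apply: (noB B); split=> // x xB; apply: contrapT => x0.
have nx : `|x| != 0 by rewrite normr_eq0; apply/eqP.
(* otherwise normalizing [x] gives a larger orthonormal set *)
pose y := `|x|^-1 *: x.
have yy : inner y y = 1.
  by rewrite /y innerZl innerZr inner_sqr_norm; field.
have yB e : B e -> inner y e = 0 by move=> Be; rewrite /y innerZl xB // mulr0.
have nBy : ~ B y by move=> /yB; rewrite yy => /eqP; rewrite oner_eq0.
apply: (Bmax (B `|` [set y])).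
  split; first by move=> e Be; left.
  by move=> /(_ y) h; apply: nBy; apply: h; right.
move=> e e' [Be|->] [Be'|->].
- exact: PB.
- by rewrite innerC yB //; case: eqP => // ey; rewrite ey in Be.
- by rewrite yB //; case: eqP => // ey; rewrite -ey in Be'.
- by rewrite yy eqxx.
Qed.

Lemma hilbert_basis_orthonormal (r : seq V) :
  (forall e, e \in r -> hilbert_basis e) -> orthonormal_on r id.
Proof. by move=> rB e e' /rB Be /rB Be'; have [+ _] := hilbert_basisP; apply. Qed.

Lemma fset_set_basis (F : set V) : finite_set F -> F `<=` hilbert_basis ->
  forall e, e \in finmap.enum_fset (fset_set F) -> hilbert_basis e.
Proof. by move=> Ff FB e; rewrite in_fset_set // inE => /FB. Qed.

(** Near-optimal finite partial sums of the coordinate expansion form a Cauchy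
    sequence; what its limit misses of [x] is orthogonal to the whole basis. *)
Lemma parseval_finite (x : V) (S : R) :
  (forall r : seq V, uniq r -> (forall e, e \in r -> hilbert_basis e) ->
    \sum_(e <- r) inner x e ^+ 2 <= S) -> `|x| ^+ 2 <= S.
Proof.
move=> xS.
pose B := [set \sum_(e <- r) inner x e ^+ 2 |
  r in [set r : seq V | uniq r /\ forall e, e \in r -> hilbert_basis e]].
have B0 : B !=set0 by exists 0, [::] => //=; rewrite big_nil.
have BS : has_sup B by split=> //; exists S => _ [r [ru rB] <-]; exact: xS.
apply: le_trans (_ : sup B <= S); last first.
  by apply: ge_sup => // _ [r [ru rB] <-]; exact: xS.
have /choice[r rP] n : exists r : seq V,
    [/\ uniq r, (forall e, e \in r -> hilbert_basis e) &
        sup B - n.+1%:R^-1 < \sum_(e <- r) inner x e ^+ 2].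
  have n0 : 0 < n.+1%:R^-1 :> R by rewrite invr_gt0.
  by have [_ [r [ru rB] <-] h] := sup_adherent n0 BS; exists r.
have ru n : uniq (r n) by have [] := rP n.
have rB n e : e \in r n -> hilbert_basis e by have [_ + _] := rP n; apply.
have rS n : sup B - n.+1%:R^-1 < \sum_(e <- r n) inner x e ^+ 2.
  by have [] := rP n.
pose y n := \sum_(e <- r n) inner x e *: e.
(* [y n] is within [sup B - S(r n)] of every longer partial sum *)
have gap n s : uniq s -> (forall e, e \in s -> hilbert_basis e) ->
    {subset r n <= s} -> `|\sum_(e <- s) inner x e *: e - y n| ^+ 2 < n.+1%:R^-1.
  move=> su sB rs.
  have perm : perm_eq s (r n ++ [seq e <- s | e \notin r n]).
    apply: uniq_perm => //.
      rewrite cat_uniq ru filter_uniq // andbT; apply/hasPn => e /=.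
      by rewrite mem_filter => /andP[].
    move=> e; rewrite mem_cat mem_filter.
    by case: (boolP (e \in r n)) => //= /rs ->.
  rewrite (perm_big _ perm) big_cat /= -/(y n) addrC addrK.
  rewrite (@pythagoras _ _ _ _ id) ?filter_uniq //; last first.
    by apply: hilbert_basis_orthonormal => e; rewrite mem_filter => /andP[_ /sB].
  have : \sum_(e <- s) inner x e ^+ 2 <= sup B.
    by apply: ub_le_sup; [case: BS|exists s].
  rewrite (perm_big _ perm) big_cat /=.
  rewrite -lerBrDl => /le_lt_trans; apply.
  by rewrite ltrBlDl -ltrBlDr.
have [z yz] : exists z : V, y @ \oo --> z.
  apply: sqr_cauchy_cvg => eps eps0.
  have [N _ NP] : \forall n \near \oo, n.+1%:R^-1 < eps / 4.
    have e4 : 0 < eps / 4 by lra.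
    have /cvgrPdist_lt /(_ _ e4) := @cvg_harmonic R; apply: filterS => n.
    by rewrite /= sub0r normrN ger0_norm // invr_ge0.
  exists N => n m Nn Nm.
  pose s := undup (r n ++ r m).
  have su : uniq s by exact: undup_uniq.
  have sB e : e \in s -> hilbert_basis e.
    by rewrite mem_undup mem_cat => /orP[/rB|/rB].
  have sn : {subset r n <= s} by move=> e er; rewrite mem_undup mem_cat er.
  have sm : {subset r m <= s} by move=> e er; rewrite mem_undup mem_cat er orbT.
  have gn := gap _ _ su sB sn; have gm := gap _ _ su sB sm.
  set t := \sum_(e <- s) _ in gn gm.
  have -> : y n - y m = (t - y m) - (t - y n).
    by rewrite opprB [RHS]addrC addrA subrK.
  apply: le_lt_trans (sqr_normB_le _ _) _.
  move: (lt_trans gn (NP _ Nn)) (lt_trans gm (NP _ Nm)).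
  by set a := `|t - y n| ^+ 2; set b := `|t - y m| ^+ 2 => ? ?; lra.
have zx : x - z = 0.
  have [_] := hilbert_basisP; apply => e Be.
  have h n : `|inner (x - y n) e| ^+ 2 <= n.+1%:R^-1.
    case: (boolP (e \in r n)) => er.
      rewrite innerBl (@inner_onsum _ _ _ _ id) //; last first.
        exact: hilbert_basis_orthonormal (rB n).
      by rewrite subrr normr0 expr0n /= invr_ge0.
    (* adding [e] to [r n] increases the sum by [<x, e>^2] *)
    have esu : uniq (e :: r n) by rewrite /= er ru.
    have esB e' : e' \in e :: r n -> hilbert_basis e'.
      by rewrite inE => /orP[/eqP->//|/rB].
    have sub : {subset r n <= e :: r n} by move=> e' er'; rewrite inE er' orbT.
    have := gap n _ esu esB sub; rewrite big_cons addrK normrZ.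
    have ee : inner e e = 1 by have [+ _] := hilbert_basisP => ->; rewrite ?eqxx.
    have -> : `|e| = 1.
      by apply/eqP; rewrite -(@eqrXn2 _ 2) // expr1n -inner_sqr_norm ee.
    rewrite mulr1 innerBl [inner (y n) e]inner_suml.
    rewrite [X in _ - X]big_seq big1 ?subr0 => [/ltW //|e' er'].
    have e'e : inner e' e = (e' == e)%:R.
      by have [+ _] := hilbert_basisP; apply=> //; exact: rB er'.
    rewrite innerZl e'e.
    by case: eqP => [ee'|_]; [rewrite -ee' er' in er|rewrite mulr0].
  have lim0 : (fun n => inner (x - y n) e) @ \oo --> inner (x - z) e.
    by apply: cvg_inner; apply: cvgB => //; exact: cvg_cst.
  apply: (cvg_seq_unique lim0).
  apply/cvgrPdist_lt => eps eps0.
  have e2 : 0 < eps ^+ 2 by rewrite exprn_gt0.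
  have /cvgrPdist_lt /(_ _ e2) := @cvg_harmonic R; apply: filterS => n.
  rewrite /= !sub0r !normrN ger0_norm ?invr_ge0 // => hn.
  by rewrite -ltr_sqr ?nnegrE ?(ltW eps0) // (le_lt_trans (h n)).
have {zx} zx : x = z by apply/eqP; rewrite -subr_eq0 zx.
have yn : (fun n => inner (y n) x) @ \oo --> `|x| ^+ 2.
  by rewrite -inner_sqr_norm; apply: cvg_inner; rewrite zx.
apply: (cvgr_to_le yn); apply: nearW => n.
rewrite inner_suml; under eq_bigr => e _ do rewrite innerZl (innerC e) -expr2.
by apply: ub_le_sup; [case: BS|exists (r n) => //; split=> //; exact: rB].
Qed.

Lemma parseval (x : V) :
  \esum_(e in hilbert_basis) (inner x e ^+ 2)%:E = (`|x| ^+ 2)%:E.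
Proof.
apply/eqP; rewrite eq_le; apply/andP; split.
  apply: ge_ereal_sup => _ [F [Ff FB] <-].
  rewrite fsbig_finite //= sumEFin lee_fin.
  apply: (@bessel _ _ _ _ id); first exact: finmap.fset_uniq.
  exact/hilbert_basis_orthonormal/fset_set_basis.
set S := esum _ _.
have S0 : (0 <= S)%E by apply: esum_ge0 => e _; rewrite lee_fin sqr_ge0.
have [->|Soo] := eqVneq S +oo%E; first exact: leey.
have Sfin : S \is a fin_num by rewrite ge0_fin_numE // ltey.
rewrite -(fineK Sfin) lee_fin; apply: parseval_finite => r ru rB.
rewrite -lee_fin (fineK Sfin); apply: esum_ge.
exists [set` r]; first by split; [exact: finite_seq|move=> e /rB].
by rewrite -fsbig_seq // sumEFin.
Qed.

(** The form in which traces are compared with sums over other systems: the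
    vectors [x i] need not be orthogonal. *)
Lemma parseval_sum (I : choiceType) (r : seq I) (x : I -> V) :
  \esum_(e in hilbert_basis) (\sum_(i <- r) inner (x i) e ^+ 2)%:E
  = (\sum_(i <- r) `|x i| ^+ 2)%:E.
Proof.
under eq_esum => e _ do rewrite -sumEFin.
rewrite esum_sum => [|e i _ _]; last by rewrite lee_fin sqr_ge0.
by rewrite -sumEFin; apply: eq_bigr => i _; exact: parseval.
Qed.

End HilbertBasis.

(** * Finite-dimensional subspaces *)

Section FiniteDim.
Context {R : realType} {V : hilbertType R}.

Definition span_of m (e : 'I_m -> V) : set V :=
  range (fun a : 'I_m -> R => \sum_i a i *: e i).

Lemma span_of_sub m n (e : 'I_m -> V) (h : 'I_n -> V) :
  (forall i, span_of h (e i)) -> span_of e `<=` span_of h.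
Proof.
move=> eh _ [a _ <-].
have /choice[c cP] i : exists c : 'I_n -> R, \sum_j c j *: h j = e i.
  by have [c _ <-] := eh i; exists c.
exists (fun j => \sum_i a i * c i j) => //=.
under eq_bigr => j _ do rewrite scaler_suml.
rewrite exchange_big /=; apply: eq_bigr => i _.
by rewrite -cP scaler_sumr; apply: eq_bigr => j _; rewrite scalerA.
Qed.

Lemma span_of_id m (e : 'I_m -> V) i : span_of e (e i).
Proof.
exists (fun j => (j == i)%:R) => //=.
rewrite (bigD1 i) //= eqxx scale1r big1 ?addr0 // => j /negbTE ->.
by rewrite scale0r.
Qed.

Lemma widen_lift_max n (i : 'I_n) : widen_ord (leqnSn n) i = lift ord_max i.
Proof. by apply: val_inj; rewrite /= /bump leqNgt ltn_ord. Qed.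

Lemma gram_schmidt m (e : 'I_m -> V) :
  (forall a : 'I_m -> R, \sum_i a i *: e i = 0 -> forall i, a i = 0) ->
  exists h : 'I_m -> V, (forall i j, inner (h i) (h j) = (i == j)%:R) /\
    span_of e = span_of h.
Proof.
(* the two inclusions of generators are easier to carry through the induction *)
suff H : (forall a : 'I_m -> R, \sum_i a i *: e i = 0 -> forall i, a i = 0) ->
  exists h : 'I_m -> V, [/\ forall i j, inner (h i) (h j) = (i == j)%:R,
    forall i, span_of h (e i) & forall i, span_of e (h i)].
  move=> /H[h [hh eh he]]; exists h; split=> //; apply/seteqP.
  by split; exact: span_of_sub.
elim: m e => [|m IH] e free; first by exists e; split=> // -[].
pose e' i := e (lift ord_max i).
have free' (a : 'I_m -> R) : \sum_i a i *: e' i = 0 -> forall i, a i = 0.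
  move=> ae i; pose b j := if unlift ord_max j is Some k then a k else 0.
  have : \sum_j b j *: e j = 0.
    rewrite big_ord_recr /= {2}/b unlift_none scale0r addr0 -[RHS]ae.
    by apply: eq_bigr => j _; rewrite widen_lift_max /b liftK.
  by move/free => /(_ (lift ord_max i)); rewrite /b liftK.
have [h [hh eh he]] := IH e' free'.
pose t := e ord_max; pose p := \sum_i inner t (h i) *: h i.
(* otherwise [t] would be a combination of the other generators *)
have tp : t - p != 0.
  apply/eqP => /eqP; rewrite subr_eq0 => /eqP te.
  have : span_of e' t.
    by apply: (span_of_sub he); rewrite te; exists (fun i => inner t (h i)).
  move=> [a _ at_].
  pose b j := if unlift ord_max j is Some k then a k else -1.
  have : \sum_j b j *: e j = 0.
    rewrite big_ord_recr /= {2}/b unlift_none scaleN1r.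
    apply/eqP; rewrite subr_eq0; apply/eqP; rewrite -[RHS]at_.
    by apply: eq_bigr => j _; rewrite widen_lift_max /b liftK.
  move/free => /(_ ord_max); rewrite /b unlift_none => /eqP.
  by rewrite oppr_eq0 oner_eq0.
have ntp : `|t - p| != 0 by rewrite normr_eq0.
pose g := `|t - p|^-1 *: (t - p).
have gh i : inner g (h i) = 0.
  rewrite /g innerZl innerBl (@inner_onsum _ _ _ (index_enum 'I_m) h) //.
    by rewrite subrr mulr0.
  exact: index_enum_uniq.
have gg : inner g g = 1 by rewrite /g innerZl innerZr inner_sqr_norm; field.
pose h' j := if unlift ord_max j is Some k then h k else g.
have h'g : h' ord_max = g by rewrite /h' unlift_none.
have h'h i : h' (lift ord_max i) = h i by rewrite /h' liftK.
have hh' : span_of h `<=` span_of h'.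
  by apply: span_of_sub => i; rewrite -h'h; exact: span_of_id.
have ee' : span_of e' `<=` span_of e.
  by apply: span_of_sub => i; exact: span_of_id.
have comb n (f : 'I_n -> V) (a b : R) x y : span_of f x -> span_of f y ->
    span_of f (a *: x + b *: y).
  move=> [c _ <-] [d _ <-]; exists (fun i => a * c i + b * d i) => //=.
  rewrite !scaler_sumr -big_split; apply: eq_bigr => i _.
  by rewrite scalerDl !scalerA.
exists h'; split.
- move=> i j; case: (unliftP ord_max i) => [i' ->|->];
    case: (unliftP ord_max j) => [j' ->|->]; rewrite ?h'g ?h'h.
  + by rewrite hh (inj_eq lift_inj).
  + by rewrite innerC gh eq_sym (negbTE (neq_lift _ _)).
  + by rewrite gh (negbTE (neq_lift _ _)).
  + by rewrite gg eqxx.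
- move=> i; case: (unliftP ord_max i) => [i' ->|->]; first exact/hh'/eh.
  have -> : e ord_max = `|t - p| *: g + 1 *: p.
    by rewrite scale1r /g scalerA mulfV // scale1r subrK.
  apply: comb; first by rewrite -h'g; exact: span_of_id.
  by apply: hh'; exists (fun i => inner t (h i)).
- move=> i; case: (unliftP ord_max i) => [i' ->|->].
    by rewrite h'h; exact/ee'/he.
  have -> : h' ord_max = `|t - p|^-1 *: t + - `|t - p|^-1 *: p.
    by rewrite h'g /g scaleNr scalerBr.
  apply: comb; first exact: span_of_id.
  by apply/ee'/(span_of_sub he); exists (fun i => inner t (h i)).
Qed.

Lemma subspace_onb (W : set V) m : subspace_of_dim W m ->
  exists h : 'I_m -> V, (forall i j, inner (h i) (h j) = (i == j)%:R) /\
    W = span_of h.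
Proof.
by move=> [e [/gram_schmidt[h [hh eh]] ->]]; exists h; split.
Qed.

Section Projection.
Variables (m : nat) (h : 'I_m -> V).
Hypothesis h_on : forall i j, inner (h i) (h j) = (i == j)%:R.

Let hu : uniq (index_enum 'I_m) := index_enum_uniq _.
Let ho : orthonormal_on (index_enum 'I_m) h := fun i j _ _ => h_on i j.

Lemma span_of_expand x : span_of h x -> \sum_i inner x (h i) *: h i = x.
Proof.
move=> [a _ <-]; apply: eq_bigr => i _.
by rewrite (@inner_onsum _ _ _ (index_enum 'I_m)) ?mem_index_enum.
Qed.

Lemma orth_projE x : orth_proj (span_of h) x = \sum_i inner x (h i) *: h i.
Proof.
rewrite /orth_proj; case: xgetP => [p _ [hp xp]|no].
  rewrite -{1}(span_of_expand hp); apply: eq_bigr => i _; congr (_ *: _).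
  apply/eqP; rewrite eq_sym -subr_eq0 -innerBl; apply/eqP/xp.
  exact: span_of_id.
exfalso; apply: (no (\sum_i inner x (h i) *: h i)).
split=> [|_ [a _ <-]]; first by exists (fun i => inner x (h i)).
rewrite inner_sumr big1 // => i _.
rewrite innerZr innerBl (@inner_onsum _ _ _ (index_enum 'I_m)) //.
by rewrite subrr mulr0.
Qed.

Lemma orth_proj_in x : span_of h (orth_proj (span_of h) x).
Proof. by rewrite orth_projE; exists (fun i => inner x (h i)). Qed.

Lemma orth_proj_id x : span_of h x -> orth_proj (span_of h) x = x.
Proof. by move=> hx; rewrite orth_projE span_of_expand. Qed.

Lemma orth_proj_orth x y :
  span_of h y -> inner (x - orth_proj (span_of h) x) y = 0.
Proof.
move=> [a _ <-]; rewrite orth_projE inner_sumr big1 // => i _.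
rewrite innerZr innerBl (@inner_onsum _ _ _ (index_enum 'I_m)) //.
by rewrite subrr mulr0.
Qed.

Lemma sqr_norm_span x : span_of h x -> `|x| ^+ 2 = \sum_i inner x (h i) ^+ 2.
Proof. by move=> hx; rewrite -{1}(span_of_expand hx) pythagoras. Qed.

End Projection.

End FiniteDim.

(** * Decay of the singular numbers *)

Section Decay.
Context {R : realType}.

(** Were the constant at most 2, the sums [A k] of the first inverse squares
    could only grow quadratically, so that [s k ^- 2] would grow at most
    linearly and the squares [s k ^+ 2] would dominate a harmonic series. *)
Lemma decay_const_ge2 (s : nat -> R) (C M : R) :
  (forall j, (0 < j)%N -> 0 < s j) ->
  (forall N, \sum_(1 <= j < N) s j ^+ 2 <= M) ->
  (forall m, (0 < m)%N ->
      m%:R / s m ^+ 2 <= C * \sum_(1 <= j < m.+1) 1 / s j ^+ 2) ->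
  2 <= C.
Proof.
move=> s0 sM sC; rewrite leNgt; apply/negP => C2.
pose a j := 1 / s j ^+ 2.
pose A k := \sum_(1 <= j < k.+1) a j.
have a0 j : (0 < j)%N -> 0 < a j by move=> /s0 sj; rewrite divr_gt0 ?exprn_gt0.
have A0 k : 0 <= A k.
  rewrite /A big_nat_cond sumr_ge0 // => j /andP[/andP[j0 _] _].
  exact/ltW/a0.
have AS k : A k.+1 = A k + a k.+1 by rewrite /A big_nat_recr.
have aA k : (0 < k)%N -> k%:R * a k <= 2 * A k.
  move=> k0; rewrite /a mul1r; apply: le_trans (sC k k0) _.
  by apply: ler_wpM2r; [exact: A0|exact: ltW].
pose c := A 2.
have c0 : 0 < c.
  by rewrite /c AS ltr_pwDr ?a0.
have step k : (0 < k)%N -> k%:R * a k.+2 <= 2 * A k.+1.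
  move=> k0; have := aA k.+2 isT; rewrite AS -addn2 natrD mulrDl mulrDr.
  by rewrite lerD2r.
have Abound k : A k.+2 <= c * (k.+1%:R * k.+2%:R).
  elim: k => [|k IH]; first by rewrite mul1r -/c ler_peMr ?(ltW c0) ?ler1n.
  have k0 : 0 < k.+1%:R :> R by rewrite ltr0n.
  have ak : a k.+3 <= 2 * c * k.+2%:R.
    rewrite -(ler_pM2l k0); apply: le_trans (step k.+1 isT) _.
    have -> : k.+1%:R * (2 * c * k.+2%:R) = 2 * (c * (k.+1%:R * k.+2%:R)) :> R.
      by ring.
    by rewrite ler_pM2l.
  rewrite AS; apply: le_trans (lerD IH ak) _.
  rewrite -subr_ge0 (_ : _ - _ = 0) // -(addn2 k.+1) -(addn1 k.+1) !natrD.
  by ring.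
have sbound i : harmonic i <= 4 * c * s i.+3 ^+ 2.
  have i0 : 0 < i.+1%:R :> R by rewrite ltr0n.
  have ss : 0 < s i.+3 ^+ 2 by rewrite exprn_gt0 ?s0.
  have ak : a i.+3 <= 4 * c * i.+1%:R.
    rewrite -(ler_pM2l i0); apply: le_trans (step i.+1 isT) _.
    apply: (@le_trans _ _ (2 * (c * (i.+1%:R * i.+2%:R)))).
      by rewrite ler_pM2l.
    have -> : i.+1%:R * (4 * c * i.+1%:R) = 2 * (c * (i.+1%:R * (i.+1%:R * 2)))
      :> R by ring.
    rewrite !ler_pM2l // -natrM ler_nat; lia.
  rewrite /harmonic /= -ler_pdivrMr // -(ler_pM2r i0) mulrC mulrA mulfV ?gt_eqF //.
have : cvgn (series (@harmonic R)).
  apply: nondecreasing_is_cvgn.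
    by apply: nondecreasing_series => i *; exact: harmonic_ge0.
  exists (4 * c * M) => _ [N _ <-].
  apply: (@le_trans _ _ (\sum_(0 <= i < N) 4 * c * s i.+3 ^+ 2)).
    by apply: ler_sum => i _; exact: sbound.
  rewrite -mulr_sumr ler_wpM2l ?mulr_ge0 ?(ltW c0) //.
  apply: le_trans (sM N.+3).
  rewrite (_ : \sum_(0 <= i < N) _ = \sum_(3 <= i < N.+3) s i ^+ 2).
    rewrite [leRHS](@big_cat_nat _ _ _ 3) //= lerDr sumr_ge0 // => i _.
    exact: sqr_ge0.
  rewrite -[3%N]/(0 + 3)%N big_addn -addn3 addnK.
  by apply: eq_bigr => i _; rewrite addn3.
exact: dvg_harmonic.
Qed.

End Decay.

(** * Singular value decomposition and effective dimension *)

Section Adjoint.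
Context {R : realType} {H K : hilbertType R}.

(** A vector with the defining property of the adjoint has to be exhibited, as
    [adjoint] is 0 where there is none. *)
Lemma adjointP (A : H -> K) y w :
  (forall z, inner (A z) y = inner z w) ->
  forall z, inner (A z) y = inner z (adjoint A y).
Proof.
by move=> Aw; rewrite /adjoint; case: xgetP => [x _ //|/(_ w)].
Qed.

End Adjoint.

Section SVD.
Context {R : realType} {H K : hilbertType R}.
Variables (T : {linear H -> K}) (s : nat -> R) (u : nat -> H) (v : nat -> K).
Hypothesis svdT : singular_system T s u v.

Lemma singular_gt0 j : (0 < j)%N -> 0 < s j.
Proof. by move=> j0; have [/(_ _ j0)[]] := svdT. Qed.

Lemma singular_nincr j k : (0 < j)%N -> (j <= k)%N -> s k <= s j.
Proof.
move=> j0; elim: k => [|k IH].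
  by rewrite leqn0 => /eqP j0'; rewrite j0' in j0.
rewrite leq_eqVlt ltnS => /orP[/eqP<-//|jk]; apply: le_trans (IH jk).
by have [+ _ _ _] := svdT => /(_ k (leq_trans j0 jk))[].
Qed.

Let u_on : forall j k, (0 < j)%N -> (0 < k)%N ->
  inner (u j) (u k) = (j == k)%:R.
Proof. by have [] := svdT. Qed.

Let v_on : forall j k, (0 < j)%N -> (0 < k)%N ->
  inner (v j) (v k) = (j == k)%:R.
Proof. by have [] := svdT. Qed.

Let on_iota (W : hilbertType R) (w : nat -> W) N :
  (forall j k, (0 < j)%N -> (0 < k)%N -> inner (w j) (w k) = (j == k)%:R) ->
  orthonormal_on (index_iota 1 N) w.
Proof.
move=> w_on i j; rewrite !mem_index_iota => /andP[i0 _] /andP[j0 _].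
exact: w_on.
Qed.

Lemma inner_svd x j : (0 < j)%N -> inner (T x) (v j) = s j * inner x (u j).
Proof.
move=> j0; have [_ _ _ /(_ x) Tx] := svdT.
exact: (inner_series_coef v_on Tx).
Qed.

Lemma inner_svd_cvg x y :
  (fun N => \sum_(1 <= j < N) s j * inner x (u j) * inner (v j) y) @ \oo
  --> inner (T x) y.
Proof.
have [_ _ _ /(_ x) Tx] := svdT.
apply: cvg_ext (cvg_inner (x := y) Tx) => N.
by rewrite inner_suml; apply: eq_bigr => j _; rewrite innerZl.
Qed.

Lemma svd_apply j y : (0 < j)%N -> inner (T (u j)) y = s j * inner (v j) y.
Proof.
move=> j0; apply: (cvg_seq_unique (@inner_svd_cvg (u j) y)).
apply: (@cvg_near_cst _ _ (s j * inner (v j) y)); exists j.+1 => // N /= jN.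
rewrite (bigD1_seq j) ?iota_uniq ?mem_index_iota ?j0 //= u_on // eqxx mulr1.
rewrite big_nat_cond big1 ?addr0 // => i /andP[/andP[i0 _] ij].
by rewrite u_on // eq_sym (negbTE ij) mulr0 mul0r.
Qed.

(** The adjoint is the series of the [s j <y, v j> u j], which converges because
    the [s j] are bounded and [y] satisfies the Bessel inequality. *)
Lemma adjoint_svd y : forall z, inner (T z) y = inner z (adjoint T y).
Proof.
have [w yw] : exists w : H,
    (\sum_(1 <= j < N) (s j * inner y (v j)) *: u j) @[N --> \oo] --> w.
  apply: (@riesz_fischer _ _ _ _ (s 1%N ^+ 2 * `|y| ^+ 2) u_on) => N.
  apply: (@le_trans _ _ (s 1%N ^+ 2 * \sum_(1 <= j < N) inner y (v j) ^+ 2)).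
    rewrite mulr_sumr big_nat_cond [leRHS]big_nat_cond.
    apply: ler_sum => j /andP[/andP[j0 _] _].
    rewrite exprMn ler_wpM2r ?sqr_ge0 // lerXn2r ?nnegrE ?(ltW (singular_gt0 _)) //.
    exact: singular_nincr.
  rewrite ler_wpM2l ?sqr_ge0 // bessel ?iota_uniq //.
  exact: on_iota.
apply: (adjointP (w := w)) => z.
have zw := cvg_inner (x := z) yw.
rewrite [RHS]innerC; apply: (cvg_seq_unique (@inner_svd_cvg z y)).
apply: cvg_ext zw => N.
rewrite inner_suml; apply: eq_bigr => j _.
by rewrite innerZl (innerC _ z) (innerC y) mulrAC.
Qed.

(** The [s j <x, u j>] are the coordinates of [T x] along the [v j]. *)
Lemma svd_lower x N :
  \sum_(1 <= j < N) s j ^+ 2 * inner x (u j) ^+ 2 <= `|T x| ^+ 2.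
Proof.
have := @bessel _ _ _ _ v (iota_uniq 1 (N - 1)) (@on_iota _ v N v_on) (T x).
apply: le_trans; rewrite le_eqVlt; apply/orP; left; apply/eqP.
rewrite big_nat_cond [RHS]big_nat_cond.
apply: eq_bigr => j /andP[/andP[j0 _] _].
by rewrite inner_svd // exprMn.
Qed.

Lemma trace_TT : trace (adjoint T \o T)
  = \esum_(e in hilbert_basis) (`|T e| ^+ 2)%:E.
Proof.
rewrite /trace; apply: eq_esum => e _ /=.
by rewrite innerC -adjoint_svd inner_sqr_norm.
Qed.

Lemma sum_sqr_singular N : hilbert_schmidt T ->
  \sum_(1 <= j < N) s j ^+ 2 <= fine (trace (adjoint T \o T)).
Proof.
move=> [_ trT].
have tr0 : (0 <= trace (adjoint T \o T))%E.
  by rewrite trace_TT esum_ge0 // => e _; rewrite lee_fin sqr_ge0.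
rewrite -lee_fin fineK ?ge0_fin_numE // trace_TT.
have -> : \sum_(1 <= j < N) s j ^+ 2 = \sum_(1 <= j < N) `|s j *: u j| ^+ 2.
  rewrite big_nat_cond [RHS]big_nat_cond.
  apply: eq_bigr => j /andP[/andP[j0 _] _].
  by rewrite -inner_sqr_norm innerZl innerZr u_on // eqxx mulr1 expr2.
rewrite -parseval_sum; apply: le_esum => e _; rewrite lee_fin.
apply: le_trans (svd_lower e N); rewrite le_eqVlt; apply/orP; left; apply/eqP.
by apply: eq_bigr => j _; rewrite innerZl exprMn (innerC e).
Qed.

Section Resolvent.
Variable lambda : R.
Hypothesis lambda_gt0 : 0 < lambda.

Let TT := adjoint T \o T.
(* the eigenvalue at [u j] of the operator whose trace is [eff_dim T lambda] *)
Let c j := s j ^+ 2 / (s j ^+ 2 + lambda).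

Let sl_gt0 j : 0 < s j ^+ 2 + lambda.
Proof. by rewrite ltr_wpDl // sqr_ge0. Qed.

Let TT_inner x y : inner (TT x) y = inner (T x) (T y).
Proof. by rewrite innerC /TT /= -adjoint_svd innerC. Qed.

(** The solution is the series of the [c j <x, u j> u j]; the equation is
    checked against an arbitrary vector [y], where it is an identity between
    partial sums. *)
Lemma resolvent_exists x : exists z, TT z + lambda *: z = TT x.
Proof.
have [z zc] : exists z : H,
    (\sum_(1 <= j < N) (c j * inner x (u j)) *: u j) @[N --> \oo] --> z.
  apply: (@riesz_fischer _ _ _ _ (`|x| ^+ 2) u_on) => N.
  apply: (@le_trans _ _ (\sum_(1 <= j < N) inner x (u j) ^+ 2)).
    apply: ler_sum => j _; rewrite exprMn ler_piMl ?sqr_ge0 //.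
    rewrite expr_le1 //; last by rewrite divr_ge0 ?sqr_ge0 // ltW.
    by rewrite ler_pdivrMr // mul1r lerDl ltW.
  by rewrite bessel ?iota_uniq //; exact: on_iota.
have zu := inner_series_coef u_on zc.
have weak y : inner (TT z + lambda *: z - TT x) y = 0.
  rewrite innerBl innerDl innerZl !TT_inner.
  apply: (cvg_seq_unique (cvgB (cvgD (@inner_svd_cvg z (T y))
    (cvgM (cvg_cst lambda) (cvg_inner (x := y) zc))) (@inner_svd_cvg x (T y)))).
  apply: (@cvg_near_cst _ _ (0 : R)); apply: nearW => N /=.
  rewrite !fctE /= inner_suml mulr_sumr -big_split -sumrB /= big_nat_cond big1 //.
  move=> j /andP[/andP[j0 _] _].
  rewrite zu // (innerC (v j)) inner_svd // innerZl (innerC (u j)) /c.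
  by field; rewrite gt_eqF.
by exists z; apply/eqP; rewrite -subr_eq0; apply/eqP/inner_eq0/weak.
Qed.

Let resolvent_TT := 'pinv_(cst 0) setT (fun x => TT x + lambda *: x) \o TT.

Let resolvent_TTP x :
  TT (resolvent_TT x) + lambda *: resolvent_TT x = TT x.
Proof.
have [z zx] := resolvent_exists x.
apply: (@pinvK _ _ (cst 0) setT (fun x => TT x + lambda *: x)).
by rewrite inE; exists z.
Qed.

(** With [z] for the image of [x], the equation
    [lambda z = T^* T (x - z)] gives
    [<z, x> = |z|^2 + |T (x - z)|^2 / lambda]. Both terms are bounded below by
    sums over the singular system, which add up to the left-hand side. *)
Let resolvent_TT_lower x N :
  \sum_(1 <= j < N) c j * inner x (u j) ^+ 2 <= inner (resolvent_TT x) x.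
Proof.
have := resolvent_TTP x; set z := resolvent_TT x => zx.
have zu j : (0 < j)%N -> inner z (u j) = c j * inner x (u j).
  move=> j0; have := congr1 (inner (u j)) zx.
  have Tu y : inner (u j) (TT y) = s j ^+ 2 * inner y (u j).
    by rewrite innerC TT_inner innerC svd_apply // innerC inner_svd // mulrA.
  rewrite innerDr innerZr !Tu (innerC (u j)) -mulrDl => e.
  by rewrite /c mulrAC -e; field; rewrite gt_eqF.
have zx_z : lambda * inner z (x - z) = `|T (x - z)| ^+ 2.
  rewrite -innerZl -inner_sqr_norm -TT_inner.
  have -> : TT (x - z) = lambda *: z.
    apply/eqP; rewrite -subr_eq0; apply/eqP/inner_eq0.
    set w := (X in inner X X = _).
    rewrite innerBl TT_inner linearB innerBl -!TT_inner -!innerBl -zx.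
    by rewrite -addrA -opprD subrr inner0l.
  by [].
(* termwise, [c^2 + s^2 (1 - c)^2 / lambda = c] *)
have -> : inner z x = `|z| ^+ 2 + `|T (x - z)| ^+ 2 / lambda.
  rewrite -inner_sqr_norm -zx_z mulrAC mulfV ?gt_eqF // mul1r innerBr.
  by rewrite addrC subrK.
apply: (@le_trans _ _ (\sum_(1 <= j < N) inner z (u j) ^+ 2
    + (\sum_(1 <= j < N) s j ^+ 2 * inner (x - z) (u j) ^+ 2) / lambda)).
  rewrite mulr_suml -big_split /= big_nat_cond [leRHS]big_nat_cond.
  rewrite le_eqVlt; apply/orP; left; apply/eqP.
  apply: eq_bigr => j /andP[/andP[j0 _] _].
  rewrite innerBl zu // /c; field.
  by rewrite !gt_eqF.
rewrite lerD //; last by rewrite ler_pM2r ?invr_gt0 // svd_lower.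
by rewrite bessel ?iota_uniq //; exact: on_iota.
Qed.

Let resolvent_TT_upper x : inner (resolvent_TT x) x <= `|T x| ^+ 2 / lambda.
Proof.
have := resolvent_TTP x; set z := resolvent_TT x => zx.
rewrite ler_pdivlMr // mulrC -innerZl.
have -> : lambda *: z = TT x - TT z by rewrite -zx addrC addKr.
rewrite innerBl !TT_inner inner_sqr_norm gerBl innerC -TT_inner -zx.
rewrite innerDl innerZl TT_inner !inner_sqr_norm addr_ge0 ?sqr_ge0 //.
by rewrite mulr_ge0 ?sqr_ge0 // ltW.
Qed.

(** The upper bound by [tr (T^* T) / lambda] is needed as well: the trace in
    [eff_dim] would be read as 0 if it were infinite. *)
Lemma eff_dim_ge N : hilbert_schmidt T ->
  \sum_(1 <= j < N) c j <= eff_dim T lambda.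
Proof.
move=> [_ trT]; rewrite /eff_dim -/TT -/resolvent_TT.
have c_ge0 j : 0 <= c j by rewrite /c divr_ge0 ?sqr_ge0 // ltW.
have lower : ((\sum_(1 <= j < N) c j)%:E <= trace resolvent_TT)%E.
  have -> : \sum_(1 <= j < N) c j
      = \sum_(1 <= j < N) `|Num.sqrt (c j) *: u j| ^+ 2.
    rewrite big_nat_cond [RHS]big_nat_cond.
    apply: eq_bigr => j /andP[/andP[j0 _] _].
    by rewrite -inner_sqr_norm innerZl innerZr u_on // eqxx mulr1 -expr2 sqr_sqrtr.
  rewrite -parseval_sum; apply: le_esum => e _; rewrite lee_fin.
  apply: le_trans (resolvent_TT_lower e N).
  rewrite le_eqVlt; apply/orP; left; apply/eqP; apply: eq_bigr => j _.
  by rewrite innerZl exprMn (innerC e) sqr_sqrtr.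
have TT_fin : trace TT \is a fin_num.
  by rewrite ge0_fin_numE // trace_TT esum_ge0 // => e _; rewrite lee_fin sqr_ge0.
have upper : (trace resolvent_TT <= (fine (trace TT) / lambda)%:E)%E.
  apply: ge_ereal_sup => _ [F FB <-].
  have [Ff _] := FB; rewrite fsbig_finite //= sumEFin lee_fin.
  set r := finmap.enum_fset _.
  apply: (@le_trans _ _ ((\sum_(e <- r) `|T e| ^+ 2) / lambda)).
    by rewrite mulr_suml; apply: ler_sum => e _; exact: resolvent_TT_upper.
  rewrite ler_pM2r ?invr_gt0 // -lee_fin fineK // trace_TT -sumEFin.
  by apply: esum_ge; exists F => //; rewrite fsbig_finite.
have fin : trace resolvent_TT \is a fin_num.
  rewrite ge0_fin_numE; first by apply: le_lt_trans upper _; rewrite ltry.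
  by apply: le_trans lower; rewrite lee_fin sumr_ge0.
by rewrite -lee_fin fineK.
Qed.

End Resolvent.

End SVD.

(** * Operator norms and traces *)

Section Opnorm.
Context {R : realType} {H K : hilbertType R}.

Lemma opnorm_ge (A : H -> K) x : `|x| <= 1 -> (`|A x|%:E <= opnorm A)%E.
Proof. by move=> x1; apply: ereal_sup_ubound; exists x. Qed.

Lemma opnorm_ge0 (A : H -> K) : (0 <= opnorm A)%E.
Proof. by apply: le_trans (opnorm_ge A (x := 0) _); rewrite ?lee_fin ?normr0. Qed.

Lemma opnorm_bound (A : {linear H -> K}) (D : R) x :
  (opnorm A <= D%:E)%E -> `|A x| <= D * `|x|.
Proof.
move=> AD; have [->|x0] := eqVneq x 0; first by rewrite linear0 !normr0 mulr0.
have nx : 0 < `|x| by rewrite normr_gt0.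
have := le_trans (opnorm_ge A (x := `|x|^-1 *: x) _) AD.
rewrite linearZ !normrZ normfV normr_id mulVf ?gt_eqF // => /(_ (lexx _)).
by rewrite lee_fin mulrC ler_pdivrMr.
Qed.

(** Expanding [|A e|^2] along the [h i] and summing over the basis first turns
    the trace into the sum of the [|A^* h i|^2]. *)
Lemma trace_adjoint_le m (h : 'I_m -> K) (A : H -> K) (rho : R) :
  (forall i j, inner (h i) (h j) = (i == j)%:R) ->
  (forall x, span_of h (A x)) ->
  (forall y z, inner (A z) y = inner z (adjoint A y)) ->
  (forall x, `|A x| <= rho * `|x|) ->
  (trace (adjoint A \o A) <= (m%:R * rho ^+ 2)%:E)%E.
Proof.
move=> hh Ah Aadj Arho.
pose w i := adjoint A (h i).
have h1 i : `|h i| = 1.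
  by apply/eqP; rewrite -(@eqrXn2 _ 2) // expr1n -inner_sqr_norm hh eqxx.
have w_le i : `|w i| ^+ 2 <= rho ^+ 2.
  have [->|w0] := eqVneq (w i) 0; first by rewrite normr0 expr0n sqr_ge0.
  have nw : 0 < `|w i| by rewrite normr_gt0.
  have wr : `|w i| <= rho.
    rewrite -(ler_pM2r nw) -expr2 -inner_sqr_norm -Aadj.
    apply: le_trans (Arho (w i)); apply: le_trans (ler_norm _) _.
    by apply: le_trans (cauchy_schwarz _ _) _; rewrite h1 mulr1.
  by rewrite lerXn2r ?nnegrE // (le_trans _ wr).
rewrite /trace.
have -> : \esum_(e in hilbert_basis) (inner ((adjoint A \o A) e) e)%:E
    = (\sum_i `|w i| ^+ 2)%:E.
  rewrite -parseval_sum; apply: eq_esum => e _ /=; congr (_%:E).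
  rewrite innerC -Aadj inner_sqr_norm (sqr_norm_span hh (Ah e)).
  by apply: eq_bigr => i _; rewrite Aadj innerC.
rewrite lee_fin; apply: le_trans (ler_sum _ (fun i _ => w_le i)) _.
by rewrite sumr_const card_ord mulr_natl.
Qed.

End Opnorm.

Section Idempotent.
Context {R : realType} {H : hilbertType R}.

Lemma norm_swap (a b : H) : `|a| != 0 -> `|b| != 0 ->
  `|(`|b| / `|a|) *: a + (`|a| / `|b|) *: b| = `|a + b|.
Proof.
move=> na nb; apply/eqP; rewrite -(@eqrXn2 _ 2) //; apply/eqP.
rewrite !sqr_normD innerZl innerZr.
have nZ (x y : H) : `|y| != 0 -> `|(`|x| / `|y|) *: y| = `|x|.
  by move=> y0; rewrite normrZ normrM normfV !normr_id divfK.
by rewrite !nZ //; field; rewrite na nb.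
Qed.

(** A nonzero idempotent and its complement have the same norm. Split
    [x = a + b] along the range and the kernel of [E]; exchanging the lengths of
    [a] and [b] keeps the length of the sum, so the bound for [E] at the new
    vector is a bound for [b]. *)
Lemma idempotent_compl_le (E : {linear H -> H}) (D : R) (x0 : H) :
  (forall x, E (E x) = E x) -> (forall x, `|E x| <= D * `|x|) ->
  x0 != 0 -> E x0 = x0 -> forall x, `|x - E x| <= D * `|x|.
Proof.
move=> EE ED x00 Ex0 x.
have nx0 : 0 < `|x0| by rewrite normr_gt0.
have D1 : 1 <= D.
  by have := ED x0; rewrite Ex0 -{1}(mul1r `|x0|) ler_pM2r.
have [a0|a0] := eqVneq (E x) 0; first by rewrite a0 subr0 ler_peMl.
have [b0|b0] := eqVneq (x - E x) 0.
  by rewrite b0 normr0 mulr_ge0 // (le_trans ler01).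
set a := E x in a0 b0 *; set b := x - a in b0 *.
have na : `|a| != 0 by rewrite normr_eq0.
have nb : `|b| != 0 by rewrite normr_eq0.
pose z := (`|b| / `|a|) *: a + (`|a| / `|b|) *: b.
have Ea : E a = a by exact: EE.
have Eb : E b = 0 by rewrite /b linearB Ea -/a subrr.
have Ez : E z = (`|b| / `|a|) *: a.
  by rewrite /z linearD !linearZ /= Ea Eb scaler0 addr0.
have nEz : `|E z| = `|b|.
  by rewrite Ez normrZ normrM normfV !normr_id divfK.
have nz : `|z| = `|x|.
  by rewrite /z norm_swap // /b addrC subrK.
by have := ED z; rewrite nEz nz.
Qed.

End Idempotent.

(** * Projection schemes *)

Section Reconstruction.
Context {R : realType} {H K : hilbertType R}.
Variables (T : {linear H -> K}) (m n : nat) (h : 'I_m -> H) (k : 'I_n -> K).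
Hypotheses (h_on : forall i j, inner (h i) (h j) = (i == j)%:R)
  (k_on : forall i j, inner (k i) (k j) = (i == j)%:R).

Let P := orth_proj (span_of h).
Let Q := orth_proj (span_of k).
Let A := Q \o T \o P.
Let B := mp_inverse A.

Hypotheses (m_gt0 : (0 < m)%N) (B_bij : set_bij (span_of k) (span_of h) B).

(** The default value of [mp_inverse] is the zero map, which cannot reach
    [h 0]. *)
Lemma mp_inverseP : is_mp_inverse A B.
Proof.
rewrite /B /mp_inverse; case: xgetP => [C -> //|noC]; exfalso.
pose i0 := Ordinal m_gt0.
have [_ _ /(_ (h i0) (span_of_id h i0))[y _]] := B_bij.
rewrite /B /mp_inverse xgetPN // => h0.
have := h_on i0 i0; rewrite -h0 inner0l eqxx => /eqP.
by rewrite eq_sym oner_eq0.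
Qed.

Let B_linear : linear B. Proof. by case: mp_inverseP. Qed.
#[local] HB.instance Definition _ := GRing.isLinear.Build R K H *:%R B B_linear.

Lemma reconstruction_bound (D : R) y :
  (opnorm B <= D%:E)%E -> `|B y| <= D * `|y|.
Proof. exact: opnorm_bound. Qed.

Lemma reconstruction_comp_bound (D : R) x :
  (opnorm (B \o T) <= D%:E)%E -> `|B (T x)| <= D * `|x|.
Proof. exact: (@opnorm_bound _ _ _ (B \o T)). Qed.

Let Q0 : Q 0 = 0.
Proof. by rewrite /Q orth_projE // big1 // => i _; rewrite inner0l scale0r. Qed.

(** [B y = B A (B y)], and the range of the self-adjoint [B A] is orthogonal to
    the kernel of [A], which contains the orthogonal complement of
    [span_of h]. *)
Lemma reconstruction_in y : span_of h (B y).
Proof.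
have [_ _ [_ BAB] _ sBA] := mp_inverseP.
pose z := B y - P (B y).
have Pz : P z = 0.
  rewrite /P orth_projE // big1 // => i _.
  by rewrite orth_proj_orth ?scale0r //; exact: span_of_id.
have Az : A z = 0 by rewrite /A /= Pz linear0 Q0.
have : z = 0.
  apply: inner_eq0; rewrite {1}/z innerBl -{1}BAB sBA Az linear0 inner0r.
  by rewrite (innerC (P _)) orth_proj_orth ?subrr //; exact: orth_proj_in.
by move/eqP; rewrite subr_eq0 => /eqP ->; exact: orth_proj_in.
Qed.

(** [B = B (A B)], and the self-adjoint [A B], having its range in [span_of k],
    vanishes on the orthogonal complement of [span_of k]. *)
Lemma reconstruction_proj y : B y = B (Q y).
Proof.
have [_ _ [_ BAB] sAB _] := mp_inverseP.
pose y' := y - Q y.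
have ABy : A (B y') = 0.
  apply: inner_eq0; rewrite sAB orth_proj_orth //.
  exact: orth_proj_in.
have By : B y' = 0 by rewrite -BAB ABy linear0.
by rewrite -[in LHS](subrK (Q y) y) linearD /= By add0r.
Qed.

(** Unique solvability puts [span_of h] in the range of [B], on which [B A] is
    the identity. *)
Lemma reconstruction_id x : span_of h x -> B (T x) = x.
Proof.
move=> hx; have [_ _ [_ BAB] _ _] := mp_inverseP.
have [_ _ /(_ x hx)[y _ yx]] := B_bij.
have -> : B (T x) = B (A x).
  by rewrite reconstruction_proj /A /= /P orth_proj_id.
by rewrite -yx BAB.
Qed.

(** Since [B = B Q] factors through a finite-dimensional space, its adjoint is a
    finite sum. *)
Lemma adjoint_reconstruction x z : inner (B z) x = inner z (adjoint B x).
Proof.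
apply: (adjointP (w := \sum_j inner (B (k j)) x *: k j)) => {}z.
rewrite reconstruction_proj /Q orth_projE // linear_sum inner_suml inner_sumr.
by apply: eq_bigr => j _; rewrite linearZ innerZl innerZr mulrC.
Qed.

Lemma trace_reconstruction_le rho : (forall y, `|B y| <= rho * `|y|) ->
  (trace (adjoint B \o B) <= (m%:R * rho ^+ 2)%:E)%E.
Proof.
move=> Brho; apply: (trace_adjoint_le h_on) => //.
- exact: reconstruction_in.
- by move=> y z; exact: adjoint_reconstruction.
Qed.

(** [B \o T] is idempotent with range [span_of h], hence its complement does not
    see [P x] and inherits the bound on [B \o T]. *)
Lemma reconstruction_error_le (D : R) x :
  (forall x, `|B (T x)| <= D * `|x|) ->
  `|x - B (T x)| <= D * `|x - P x|.
Proof.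
move=> BTD; pose E : {linear H -> H} := B \o T.
pose i0 := Ordinal m_gt0.
have h0 : h i0 != 0.
  apply/eqP => h0; have := h_on i0 i0; rewrite h0 inner0l eqxx => /eqP.
  by rewrite eq_sym oner_eq0.
have -> : x - B (T x) = (x - P x) - E (x - P x).
  rewrite linearB /= (reconstruction_id (orth_proj_in _ x)) //.
  by rewrite opprB addrA subrK.
apply: (idempotent_compl_le (x0 := h i0)) => //.
- by move=> y /=; rewrite reconstruction_id //; exact: reconstruction_in.
- by rewrite /= reconstruction_id //; exact: span_of_id.
Qed.

End Reconstruction.

(** * The oracle inequality *)

Section Oracle.
Context {R : realType}.

Lemma xlog_ge0 (a : R) : 0 < a < 1 -> 0 <= xlog a.
Proof.
by move=> /andP[a0 a1]; rewrite /xlog ln_ge0 // ler_pdivlMr // mul1r ltW.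
Qed.

Lemma Cstar_ge0 (alpha beta : R) : 0 <= Cstar alpha beta.
Proof. by rewrite /Cstar addr_ge0 // mulr_ge0. Qed.

Lemma v2_ge0 (H K : hilbertType R) (sigma : R) (A : K -> H) : 0 <= v2 sigma A.
Proof. by rewrite /v2 mulr_ge0 ?sqr_ge0. Qed.

Lemma radius2_ge0 (H K : hilbertType R) (alpha beta sigma : R) (A : K -> H) :
  0 < alpha < 1 -> 0 < beta < 1 -> 0 <= radius2 alpha beta sigma A.
Proof.
move=> /xlog_ge0 a0 /xlog_ge0 b0; rewrite /radius2 addr_ge0 //.
  by rewrite !mulr_ge0 ?Cstar_ge0.
by rewrite mulr_ge0 ?v2_ge0 // addr_ge0 // mulr_ge0.
Qed.

(** The arithmetic of the noise term, with [N] for the effective dimension, [W]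
    for [sigma^2 / s_m^2], [D] for [D_R^2 / C_B^2] and [F] for
    [phi(s_m^2)^2]. *)
Lemma radius2_le (H K : hilbertType R) (alpha beta sigma : R) (A : K -> H)
    (m : nat) (W F D Cr N : R) :
  0 < alpha < 1 -> 0 < beta < 1 -> 0 < N -> 0 <= Cr -> 0 <= D ->
  S2 sigma A <= m%:R * v2 sigma A -> v2 sigma A <= D * W ->
  m%:R <= Cr ^+ 2 * N -> W * Num.sqrt N <= F ->
  radius2 alpha beta sigma A <= (Cstar alpha beta * D * Cr
    + (4 * xlog alpha + 8 * xlog beta) * D * (1 / Num.sqrt N)) * F.
Proof.
move=> /xlog_ge0 a0 /xlog_ge0 b0 N0 Cr0 D0 S2le v2le mle WF.
set V := v2 sigma A in S2le v2le *; have V0 : 0 <= V := v2_ge0 _ _.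
have q0 : 0 < Num.sqrt N by rewrite sqrtr_gt0.
set q := Num.sqrt N in WF q0 *.
have Cst0 := Cstar_ge0 alpha beta.
set L := 4 * xlog alpha + 8 * xlog beta.
have L0 : 0 <= L by rewrite /L addr_ge0 // mulr_ge0.
have SV : Num.sqrt (S2 sigma A) * Num.sqrt V <= Cr * D * F.
  have sS : Num.sqrt (S2 sigma A) <= Cr * q * Num.sqrt V.
    apply: le_trans (ler_wsqrtr S2le) _; rewrite sqrtrM // ler_wpM2r //.
    apply: le_trans (ler_wsqrtr mle) _.
    by rewrite sqrtrM ?sqr_ge0 // sqrtr_sqr ger0_norm.
  apply: (@le_trans _ _ (Cr * q * V)).
    by rewrite -[V in leRHS]sqr_sqrtr // expr2 mulrA ler_wpM2r.
  rewrite -!mulrA ler_wpM2l // mulrC.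
  apply: (@le_trans _ _ (D * W * q)); first by rewrite ler_wpM2r // ltW.
  by rewrite -mulrA ler_wpM2l.
have VF : V <= D * (1 / q) * F.
  apply: le_trans v2le _; rewrite -mulrA ler_wpM2l // mul1r mulrC.
  by rewrite ler_pdivlMr.
rewrite /radius2 -/V -/L [leRHS]mulrDl -!mulrA lerD //.
  by rewrite ler_wpM2l // [D * _]mulrA (mulrC D Cr).
by apply: le_trans (ler_wpM2l L0 VF) _; rewrite !mulrA.
Qed.

(** The first [m] eigenvalues [s j ^+ 2 / (s j ^+ 2 + s m ^+ 2)] are at least
    1/2. *)
Lemma eff_dim_ge_half (H K : hilbertType R) (T : {linear H -> K}) (s : nat -> R)
    (u : nat -> H) (v : nat -> K) m :
  singular_system T s u v -> hilbert_schmidt T -> (0 < m)%N ->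
  m%:R <= 2 * eff_dim T (s m ^+ 2).
Proof.
move=> svdT hsT m0; have sm := singular_gt0 svdT m0.
have l0 : 0 < s m ^+ 2 by rewrite exprn_gt0.
have := eff_dim_ge svdT l0 m.+1 hsT; rewrite -(ler_pM2l (ltr0Sn R 1)).
apply: le_trans; rewrite mulr_sumr.
have {1}-> : m%:R = \sum_(1 <= j < m.+1) (1 : R).
  by rewrite sumr_const_nat subn1.
rewrite big_nat_cond [leRHS]big_nat_cond.
apply: ler_sum => j /andP[/andP[j0 jm] _].
have sj := singular_gt0 svdT j0.
have sjm : s m ^+ 2 <= s j ^+ 2.
  by rewrite lerXn2r ?nnegrE ?(ltW sj) ?(ltW sm) // (singular_nincr svdT).
rewrite mulrA ler_pdivlMr ?mul1r ?addr_gt0 ?exprn_gt0 //.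
by rewrite mulr_natl mulr2n lerD2l.
Qed.

End Oracle.

Theorem theorem3p2 (R : realType) (H K : hilbertType R)
    (sepH : separable H) (sepK : separable K)
    (T : {linear H -> K}) (hsT : hilbert_schmidt T)
    (s : nat -> R) (u : nat -> H) (v : nat -> K)
    (svdT : singular_system T s u v)
    (Cr : R) (Cr_gt0 : 0 < Cr)
    (Cr_bound : forall m, (0 < m)%N ->
      m%:R / s m ^+ 2 <= Cr ^+ 2 * \sum_(1 <= j < m.+1) 1 / s j ^+ 2)
    (Hm : nat -> set H) (Kn : nat -> set K) (n : nat -> nat)
    (scheme : projection_scheme T Hm Kn n)
    (DQ DR : R)
    (qopt : quasi_optimal T (reconstruction T Hm Kn n) DQ)
    (rob : robust T Hm (reconstruction T Hm Kn n) DR)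
    (phi : R -> R) (phi_index : index_function phi)
    (CD : R) (approx : degree_of_approximation s u Hm phi CD)
    (CB : R) (bern : bernstein T s Hm CB)
    (alpha beta sigma : R)
    (alpha01 : 0 < alpha < 1) (beta01 : 0 < beta < 1) (sigma_gt0 : 0 < sigma)
    (mstar : nat)
    (mstar_max : is_max_index
      (fun m => phi (s m ^+ 2) ^+ 2 >=
                sigma ^+ 2 * (Num.sqrt (eff_dim T (s m ^+ 2)) / s m ^+ 2))
      mstar)
    (f : H) (f_source : source_set s u phi f) :
  inf [set radius2 alpha beta sigma (reconstruction T Hm Kn n m)
           + `|f - reconstruction T Hm Kn n m (T f)| ^+ 2
       | m in [set m | (0 < m)%N]]
  <= (Cstar alpha beta * (DR ^+ 2 / CB ^+ 2) * Cr
      + (4 * xlog alpha + 8 * xlog beta) * (DR ^+ 2 / CB ^+ 2)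
        * (1 / Num.sqrt (eff_dim T (s mstar ^+ 2)))
      + DQ ^+ 2 * CD ^+ 2) * phi (s mstar ^+ 2) ^+ 2.
Proof.
pose B m := reconstruction T Hm Kn n m.
have [chH chK nP] := scheme.
have [m0 mP _] := mstar_max; have [n0 Bbij] := nP _ m0.
have [CB0 _ bernP] := bern; have {bernP} jP := bernP _ m0.
have [dimH _] := chH _ m0; have [dimK _] := chK _ n0.
have [h [hh Hh]] := subspace_onb dimH; have [k [kk Kk]] := subspace_onb dimK.
set M := mstar in m0 mP n0 Bbij jP dimH dimK h hh Hh k kk Kk *.
have sM := singular_gt0 svdT m0.
have l0 : 0 < s M ^+ 2 by rewrite exprn_gt0.
have BE : B M = mp_inverse (orth_proj (span_of k) \o T \o orth_proj (span_of h)).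
  by rewrite /B /reconstruction Hh Kk.
have {}Bbij : set_bij (span_of k) (span_of h)
    (mp_inverse (orth_proj (span_of k) \o T \o orth_proj (span_of h))).
  by rewrite -BE -Hh -Kk.
apply: (@le_trans _ _
    (radius2 alpha beta sigma (B M) + `|f - B M (T f)| ^+ 2)).
  apply: inf_lbound; last by exists M.
  exists 0 => _ [m _ <-].
  by rewrite addr_ge0 ?sqr_ge0 // radius2_ge0.
rewrite [leRHS]mulrDl lerD //.
- have Cr2 : 2 <= Cr ^+ 2.
    apply: (decay_const_ge2 (singular_gt0 svdT) _ Cr_bound) => N.
    exact: (sum_sqr_singular svdT).
  have Nge := eff_dim_ge_half svdT hsT m0.
  have N0 : 0 < eff_dim T (s M ^+ 2).
    have : 0 < M%:R :> R by rewrite ltr0n.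
    by move=> /lt_le_trans /(_ Nge); rewrite pmulr_rgt0.
  have op_le := rob M m0; rewrite -/(B M) in op_le.
  set j := injectivity_modulus T (Hm M) in jP op_le.
  have j0 : 0 < j by apply: lt_le_trans jP; rewrite mulr_gt0.
  have op_ge0 := opnorm_ge0 (B M).
  have op_fin : opnorm (B M) \is a fin_num.
    by rewrite ge0_fin_numE // (le_lt_trans op_le) // ltry.
  set rho := fine (opnorm (B M)).
  have opE : opnorm (B M) = rho%:E by rewrite fineK.
  have rho0 : 0 <= rho by rewrite fine_ge0.
  have rhoD : rho * (CB * s M) <= DR.
    apply: (@le_trans _ _ (rho * j)); first by rewrite ler_wpM2l.
    by rewrite -ler_pdivlMr // -lee_fin -opE.
  have rho2 : rho ^+ 2 <= DR ^+ 2 / CB ^+ 2 * (s M ^+ 2)^-1.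
    rewrite -mulrA -invfM ler_pdivlMr ?mulr_gt0 ?exprn_gt0 // -!exprMn.
    have r0 : 0 <= rho * (CB * s M) by rewrite !mulr_ge0 // ltW.
    by rewrite lerXn2r ?nnegrE // (le_trans r0).
  apply: (@radius2_le _ _ _ _ _ _ _ M (sigma ^+ 2 / s M ^+ 2)) => //.
  + exact: ltW.
  + by rewrite divr_ge0 // sqr_ge0.
  + rewrite /S2 /v2 -/rho [leRHS]mulrCA ler_wpM2l ?sqr_ge0 //.
    have trle : (trace (adjoint (B M) \o B M) <= (M%:R * rho ^+ 2)%:E)%E.
      rewrite BE; apply: (trace_reconstruction_le hh kk m0 Bbij) => y.
      by apply: (reconstruction_bound hh m0 Bbij); rewrite -BE opE.
    have tr0 : (0 <= trace (adjoint (B M) \o B M))%E.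
      apply: esum_ge0 => e _ /=; rewrite BE innerC.
      rewrite -(adjoint_reconstruction hh kk m0 Bbij) lee_fin.
      by rewrite inner_sqr_norm sqr_ge0.
    rewrite -lee_fin fineK // ge0_fin_numE //.
    by apply: le_lt_trans trle _; rewrite ltry.
  + by rewrite /v2 -/rho [leRHS]mulrCA ler_wpM2l ?sqr_ge0.
  + by apply: le_trans Nge _; rewrite ler_pM2r.
  + by rewrite mulrAC -mulrA.
- have DQP := qopt M m0; rewrite -/(B M) in DQP.
  have DQ0 : 0 <= DQ by rewrite -lee_fin (le_trans _ DQP) // opnorm_ge0.
  have err : `|f - B M (T f)| <= DQ * `|f - orth_proj (span_of h) f|.
    rewrite BE; apply: (reconstruction_error_le hh kk m0 Bbij) => x.
    by apply: (reconstruction_comp_bound hh m0 Bbij); rewrite -BE.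
  have [_ phi_nd phi0 _] := phi_index.
  have fP : `|f - orth_proj (span_of h) f| <= CD * phi (s M.+1 ^+ 2).
    have [w w1 <-] := f_source; rewrite -Hh -lee_fin.
    by apply: le_trans (approx M m0); apply: (opnorm_ge _ w1).
  apply: (@le_trans _ _ ((DQ * (CD * phi (s M.+1 ^+ 2))) ^+ 2)).
    have b0 : `|f - B M (T f)| <= DQ * (CD * phi (s M.+1 ^+ 2)).
      by apply: le_trans err _; rewrite ler_wpM2l.
    by rewrite lerXn2r ?nnegrE // (le_trans _ b0).
  rewrite !exprMn mulrA ler_wpM2l ?(mulr_ge0 (sqr_ge0 _) (sqr_ge0 _)) //.
  rewrite lerXn2r ?nnegrE ?phi0 ?sqr_ge0 // phi_nd ?sqr_ge0 //.
  have sS := singular_gt0 svdT (ltn0Sn M).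
  by rewrite lerXn2r ?nnegrE ?(ltW sS) ?(ltW sM) // (singular_nincr svdT).
Qed.
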